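(* Let $f$ be a non-square positive integer with $\sqrt{f}=[\,a_0;\overline{a_1,\dots,a_n,2a_0}\,]$, and let $(c,h)$ be the smallest pair of positive integers with $c^2-fh^2=1$. Let $f(t)=(c-1)^2h^2t^2+2(c-1)^2t+f$. Let $t\ge 0$ be an integer. (i) If $n$ is even, then $$\sqrt{f(t)}=[\,(c-1)ht+a_0;\overline{a_1,\dots,a_n,2(c-1)ht+2a_0}\,].$$ (ii) If $n$ is odd and $\sqrt{f}=[\,a_0;\overline{a_1,\dots,a_{m-1},a_m,a_{m-1},\dots,a_1,2a_0}\,]$ with $a_m=a_0$ or $a_m=a_0-1$ and $m$ odd, then $$\sqrt{f(t)}=[\,(c-1)ht+a_0;\overline{a_1,\dots,a_{m-1},(c-1)ht+a_m,a_{m-1},\dots,a_1,2(c-1)ht+2a_0}\,].$$ (iii) Under the hypotheses of either (i) or (ii), $X=(c-1)h^4t^2+2(c-1)h^2t+c$, $Y=h^3t+h$ is the fundamental solution (smallest solution in positive integers) of $X^2-f(t)Y^2=1$.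
   Context: $[\,b_0;\overline{b_1,\dots,b_k}\,]$ denotes the simple periodic continued fraction with the overlined block repeating; the period of $\sqrt f=[\,a_0;\overline{a_1,\dots,a_n,2a_0}\,]$ has length $n+1$. The fundamental solution of $X^2-DY^2=1$ is its smallest solution in positive integers.
   Formalization: In (ii) the cases f=8 and f=12 with t≥1 are excluded, since the formula fails there (f=8, t=1: √20=[4;2,8], not [4;3,8]; f=12, t=1: √228=[15;10,30], not [15;14,30]); ''m odd'' is required both for a_m=a_0 and for a_m=a_0-1. *)

(* Defs.v *)
From Stdlib Require Export Reals ZArith List.
From Coquelicot Require Export Coquelicot.
Export ListNotations.
Local Open Scope Z_scope.

(** [b 0; b 1, ..., b k] *)
Fixpoint cf_fin (b : nat -> Z) (k : nat) : R :=
  match k with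
  | O => IZR (b O)
  | S k' => (IZR (b O) + / cf_fin (fun i => b (S i)) k')%R
  end.

(** Partial quotients of [b0; block, block, ...]: index 0 is [b0], the block is
    read cyclically from index 1 on. *)
Definition periodic_quotients (b0 : Z) (block : list Z) (i : nat) : Z :=
  match i with
  | O => b0
  | S j => nth (Nat.modulo j (length block)) block 0
  end.

(** [x] is the value of the simple continued fraction [b0; block, block, ...].
    The block need not be the shortest one. *)
Definition is_periodic_cf (x : R) (b0 : Z) (block : list Z) : Prop :=
  block <> [] /\
  List.Forall (fun b => 0 < b) block /\
  is_lim_seq (cf_fin (periodic_quotients b0 block)) (Finite x).

Definition is_period (b0 : Z) (block : list Z) (p : nat) : Prop :=
  (0 < p)%nat /\
  forall i : nat, (1 <= i)%nat ->
    periodic_quotients b0 block (i + p) = periodic_quotients b0 block i.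

Definition least_period_block (b0 : Z) (block : list Z) : Prop :=
  forall p : nat, is_period b0 block p -> (length block <= p)%nat.

(** [a 1; ...; a n] *)
Definition quotients_upto (a : nat -> Z) (n : nat) : list Z := map a (seq 1 n).

(** sqrt f = [a 0; a 1, ..., a n, 2 * a 0 repeated], where n + 1 is the length
    of the (shortest) period. *)
Definition sqrt_expansion (f : Z) (n : nat) (a : nat -> Z) : Prop :=
  let block := quotients_upto a n ++ [2 * a O] in
  is_periodic_cf (sqrt (IZR f)) (a O) block /\ least_period_block (a O) block.

(** a 1, ..., a (m-1), x, a (m-1), ..., a 1 *)
Definition palindrome (a : nat -> Z) (m : nat) (x : Z) : list Z :=
  quotients_upto a (m - 1) ++ [x] ++ rev (quotients_upto a (m - 1)).

(** Smallest in both coordinates; since X determines Y and increases with it,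
    this is the smallest solution for any of the usual orderings. *)
Definition is_fundamental_solution (D X Y : Z) : Prop :=
  (0 < X /\ 0 < Y /\ X ^ 2 - D * Y ^ 2 = 1) /\
  forall X' Y' : Z,
    0 < X' -> 0 < Y' -> X' ^ 2 - D * Y' ^ 2 = 1 -> X <= X' /\ Y <= Y'.

Definition f_t (f c h t : Z) : Z :=
  (c - 1) ^ 2 * h ^ 2 * t ^ 2 + 2 * (c - 1) ^ 2 * t + f.

(** The equation between lists says that a 1, ..., a n is the palindrome with
    middle term a m; it forces n = 2 m - 1. *)
Definition odd_case (n m : nat) (a : nat -> Z) : Prop :=
  Nat.Odd n /\
  quotients_upto a n = palindrome a m (a m) /\
  (a m = a O \/ a m = a O - 1) /\
  Nat.Odd m.

(* Main.v *)
(** If [M] is the product of the matrices [[b, 1], [1, 0]] over a block [l] of partial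
    quotients, then [sqrt D = [A0; l, 2 A0, ...]] holds exactly when [M] is symmetric and
    [m11 M * D = A0^2 * m11 M + 2 * A0 * m21 M + m22 M].  With [p = A0 * m11 M + m21 M] and
    [q = m11 M], replacing [A0] by [A0 + s] adds [s^2 + 2 s p / q] to [D].

    Units of norm 1 or -1 are convergents, by Euclid's algorithm on the matrix of
    multiplication by the unit, and they occur only where the complete quotient is
    [sqrt D + A0]; so [(p, q)] is the least unit if [l] is the least period, or if all terms
    of [l] are below [2 A0].

    For even [n], [p^2 - f q^2 = -1], [c = 2 p^2 + 1], [h = 2 p q], and [s = (c - 1) h t]
    gives [f(t)].  For odd [n] the period is a palindrome with middle complete quotient
    [(P + sqrt f) / Q], [Q a_m = 2 P]; the hypothesis on [a_m] leaves only [Q = 2], up to the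
    exceptions [f = 8] and [f = 12].  Then the convergent [p/u] before the middle has
    [p^2 - f u^2 = -2], [c = p^2 + 1], [h = p u], and both shifts by [s] are checked on the
    matrices.  In the two exceptional cases
    [sqrt (4 k^2 + 4) = [2 k; k, 4 k, ...]] and [sqrt (9 k^2 + 3) = [3 k; 2 k, 6 k, ...]]
    still give the fundamental solution. *)

Require Import Defs.
From Stdlib Require Import Lia Lra.
Local Open Scope Z_scope.

(** * Continuant matrices and complete quotients *)

Record mat2 := Mat2 { m11 : Z; m12 : Z; m21 : Z; m22 : Z }.

Definition mmul (A B : mat2) : mat2 :=
  Mat2 (m11 A * m11 B + m12 A * m21 B) (m11 A * m12 B + m12 A * m22 B)
       (m21 A * m11 B + m22 A * m21 B) (m21 A * m12 B + m22 A * m22 B).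

Definition mtr (A : mat2) : mat2 := Mat2 (m11 A) (m21 A) (m12 A) (m22 A).

Definition mdet (A : mat2) : Z := m11 A * m22 A - m12 A * m21 A.

Definition mstep (b : Z) : mat2 := Mat2 b 1 1 0.

Definition cfmat (l : list Z) : mat2 :=
  fold_right (fun b M => mmul (mstep b) M) (Mat2 1 0 0 1) l.

Lemma mat2_eq (A B : mat2) :
  m11 A = m11 B -> m12 A = m12 B -> m21 A = m21 B -> m22 A = m22 B -> A = B.
Proof. destruct A, B; simpl; congruence. Qed.

Ltac mat_ring := apply mat2_eq; cbn -[Z.mul Z.add cfmat]; ring.

Lemma mmulA (A B C : mat2) : mmul A (mmul B C) = mmul (mmul A B) C.
Proof. mat_ring. Qed.

Lemma mtr_mul (A B : mat2) : mtr (mmul A B) = mmul (mtr B) (mtr A).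
Proof. mat_ring. Qed.

Lemma cfmat_cons (b : Z) (l : list Z) : cfmat (b :: l) = mmul (mstep b) (cfmat l).
Proof. reflexivity. Qed.

Lemma cfmat_app (l1 l2 : list Z) : cfmat (l1 ++ l2) = mmul (cfmat l1) (cfmat l2).
Proof.
induction l1 as [|b l1 IH].
- apply mat2_eq; cbn -[Z.mul Z.add cfmat fold_right]; cbn [cfmat fold_right m11 m12 m21 m22]; ring.
- rewrite <- app_comm_cons, !cfmat_cons, IH. apply mmulA.
Qed.

Lemma cfmat_rev (l : list Z) : cfmat (rev l) = mtr (cfmat l).
Proof.
induction l as [|b l IH].
- reflexivity.
- simpl rev. rewrite cfmat_app, (cfmat_cons b l), mtr_mul, IH.
  apply mat2_eq; cbn -[Z.mul Z.add fold_right]; cbn [cfmat fold_right mmul m11 m12 m21 m22 mstep]; ring.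
Qed.

Lemma mdet_mul (A B : mat2) : mdet (mmul A B) = mdet A * mdet B.
Proof. unfold mdet; simpl; ring. Qed.

Lemma mdet_cfmat (l : list Z) :
  mdet (cfmat l) = if Nat.even (length l) then 1 else -1.
Proof.
induction l as [|b l IH].
- reflexivity.
- rewrite cfmat_cons, mdet_mul, IH.
  change (length (b :: l)) with (S (length l)).
  rewrite Nat.even_succ, <- Nat.negb_even.
  replace (mdet (mstep b)) with (-1) by (unfold mdet; cbn -[Z.mul]; ring).
  destruct (Nat.even (length l)); reflexivity.
Qed.

(** The bound on [m12 + m22] carries the induction: it keeps the new [m12] below the new [m11]. The
    entry [m21] vanishes only for the empty list. *)
Lemma cfmat_bounds (l : list Z) :
  List.Forall (fun b => 0 < b) l ->
  1 <= m11 (cfmat l) /\ 0 <= m12 (cfmat l) <= m11 (cfmat l) /\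
  0 <= m21 (cfmat l) <= m11 (cfmat l) /\ 0 <= m22 (cfmat l) /\
  m12 (cfmat l) + m22 (cfmat l) <= m11 (cfmat l) + m21 (cfmat l) /\
  (m21 (cfmat l) = 0 -> m12 (cfmat l) = 0).
Proof.
induction 1 as [|b l Hb Hl IH]; [simpl; lia|].
rewrite cfmat_cons.
destruct (cfmat l) as [A B E C]; cbn -[Z.mul Z.add] in *.
repeat split; nia.
Qed.

(** The [x i] are the complete quotients. The strict bound makes [b i] the integer part of [x i], so
    [x 0] determines all terms, and those after the first are positive. *)
Definition expansion (b : nat -> Z) (x : nat -> R) : Prop :=
  forall i, x i = (IZR (b i) + / x (S i))%R /\ (1 < x (S i))%R.

Lemma expansion_tail (b : nat -> Z) (x : nat -> R) (k : nat) :
  expansion b x -> expansion (fun i => b (k + i)%nat) (fun i => x (k + i)%nat).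
Proof. intros H i; rewrite Nat.add_succ_r; apply H. Qed.

Lemma expansion_S (b : nat -> Z) (x : nat -> R) :
  expansion b x -> expansion (fun i => b (S i)) (fun i => x (S i)).
Proof. intros H; exact (expansion_tail b x 1 H). Qed.

Lemma inv_lt_1 (x : R) : (1 < x -> 0 < / x < 1)%R.
Proof.
intros H; split; [apply Rinv_0_lt_compat; lra|].
rewrite <- Rinv_1; apply Rinv_lt_contravar; lra.
Qed.

Lemma expansion_bounds (b : nat -> Z) (x : nat -> R) (i : nat) :
  expansion b x -> (IZR (b i) < x i < IZR (b i) + 1)%R.
Proof. intros H; destruct (H i) as [E L]; apply inv_lt_1 in L; lra. Qed.

Lemma expansion_pos (b : nat -> Z) (x : nat -> R) (i : nat) :
  expansion b x -> 0 < b (S i).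
Proof.
intros H. generalize (expansion_bounds b x (S i) H); intros [_ K].
destruct (H i) as [_ L].
assert (0 < IZR (b (S i)))%R as M by lra. now apply lt_IZR in M.
Qed.

Lemma digit_unique (b b' : Z) (x x' : R) :
  (1 < x -> 1 < x' -> IZR b + / x = IZR b' + / x' -> b = b' /\ x = x')%R.
Proof.
intros H H' E.
assert (b = b') as <-.
{ generalize (inv_lt_1 _ H) (inv_lt_1 _ H'); intros K K'.
  assert (b < b' + 1) by (apply lt_IZR; rewrite plus_IZR; lra).
  assert (b' < b + 1) by (apply lt_IZR; rewrite plus_IZR; lra).
  lia. }
split; [reflexivity|]. apply Rinv_eq_reg; lra.
Qed.

Lemma expansion_unique (b b' : nat -> Z) (x x' : nat -> R) :
  expansion b x -> expansion b' x' -> x O = x' O ->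
  forall i, b i = b' i /\ x i = x' i.
Proof.
intros H H' E0.
assert (forall i, x i = x' i -> b i = b' i /\ x (S i) = x' (S i)) as step.
{ intros i E. destruct (H i) as [E1 L1]; destruct (H' i) as [E2 L2].
  apply digit_unique; congruence. }
intros i; assert (x i = x' i) as E.
{ induction i as [|i IH]; [exact E0|]. now apply step. }
split; [now apply step|exact E].
Qed.

(** * Convergence of simple continued fractions *)

Lemma cf_fin_ge (b : nat -> Z) (k : nat) :
  (forall i, 0 < b i) -> (IZR (b O) <= cf_fin b k <= IZR (b O) + 1)%R.
Proof.
revert b; induction k as [|k IH]; intros b Hb; simpl; [lra|].
assert (1 <= cf_fin (fun i => b (S i)) k)%R as L.
{ destruct (IH (fun i => b (S i)) (fun i => Hb (S i))) as [K _].
  apply Rle_trans with (2 := K). apply IZR_le. specialize (Hb 1%nat). lia. }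
assert (0 < / cf_fin (fun i => b (S i)) k)%R by (apply Rinv_0_lt_compat; lra).
assert (/ cf_fin (fun i => b (S i)) k <= 1)%R.
{ rewrite <- Rinv_1. apply Rinv_le_contravar; lra. }
lra.
Qed.

Lemma cf_fin_ge1 (b : nat -> Z) (k : nat) :
  (forall i, 0 < b i) -> (1 <= cf_fin b k)%R.
Proof.
intros Hb; destruct (cf_fin_ge b k Hb) as [K _].
apply Rle_trans with (2 := K). apply IZR_le. specialize (Hb O). lia.
Qed.

Lemma inv_dist (y x : R) :
  (0 < y -> 0 < x -> Rabs (/ y - / x) = Rabs (y - x) / (y * x))%R.
Proof.
intros Hy Hx.
replace (/ y - / x)%R with (- (y - x) / (y * x))%R by (field; lra).
unfold Rdiv; rewrite Rabs_mult, Rabs_Ropp, (Rabs_pos_eq (/ (y * x))).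
- reflexivity.
- apply Rlt_le, Rinv_0_lt_compat, Rmult_lt_0_compat; assumption.
Qed.

(* A single step need not contract, but [y1 y2 = b1 y2 + 1 >= 2] along two steps. *)
Lemma cf_fin_contract (b : nat -> Z) (x : nat -> R) (k : nat) :
  expansion b x ->
  (Rabs (cf_fin b (S (S k)) - x O) <=
   / 4 * Rabs (cf_fin (fun i => b (S (S i))) k - x 2%nat))%R.
Proof.
intros H.
assert (1 <= cf_fin (fun i => b (S (S i))) k)%R as L2
  by (apply cf_fin_ge1; intros i; exact (expansion_pos b x (S i) H)).
change (cf_fin b (S (S k))) with
  (IZR (b O) + / (IZR (b 1%nat) + / cf_fin (fun i => b (S (S i))) k))%R.
set (y := cf_fin (fun i => b (S (S i))) k) in *.
destruct (H O) as [-> K1]; destruct (H 1%nat) as [E1 K2].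
assert (1 <= IZR (b 1%nat))%R as B1.
{ apply IZR_le. generalize (expansion_pos b x 0 H); lia. }
assert (0 < / y)%R by (apply Rinv_0_lt_compat; lra).
assert (0 < / x 2%nat)%R by (apply Rinv_0_lt_compat; lra).
replace (_ - _)%R with (/ (IZR (b 1%nat) + / y) - / x 1%nat)%R by ring.
rewrite inv_dist by lra. rewrite E1.
replace (_ + _ - _)%R with (/ y - / x 2%nat)%R by ring.
rewrite inv_dist by lra.
assert (2 <= y * (IZR (b 1%nat) + / y))%R as P1.
{ replace (y * (IZR (b 1%nat) + / y))%R with (IZR (b 1%nat) * y + 1)%R by (field; lra). nra. }
assert (2 <= x 2%nat * (IZR (b 1%nat) + / x 2%nat))%R as P2.
{ replace (x 2%nat * (IZR (b 1%nat) + / x 2%nat))%R with (IZR (b 1%nat) * x 2%nat + 1)%R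
    by (field; lra). nra. }
replace (Rabs (y - x 2%nat) / (y * x 2%nat) / _)%R with
  (/ ((y * (IZR (b 1%nat) + / y)) * (x 2%nat * (IZR (b 1%nat) + / x 2%nat))) *
   Rabs (y - x 2%nat))%R.
2:{ field. repeat split; nra. }
apply Rmult_le_compat_r; [apply Rabs_pos|].
apply Rinv_le_contravar; nra.
Qed.

Lemma cf_fin_dist (b : nat -> Z) (x : nat -> R) (k : nat) :
  expansion b x ->
  (Rabs (cf_fin b k - x O) <= 2 * (/ 2) ^ k)%R.
Proof.
revert b x.
(* The contraction moves two indices at a time, so bounds at two consecutive indices are carried
   together. *)
cut (forall b x, expansion b x ->
  (Rabs (cf_fin b k - x O) <= 2 * (/ 2) ^ k)%R /\
  (Rabs (cf_fin b (S k) - x O) <= 2 * (/ 2) ^ (S k))%R).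
{ intros K b x H; apply K; exact H. }
induction k as [|k IH]; intros b x H.
- destruct (H O) as [E L]. generalize (inv_lt_1 _ L); intros L'.
  destruct (H 1%nat) as [E1 L1]. generalize (inv_lt_1 _ L1); intros L1'.
  assert (1 <= IZR (b 1%nat))%R as B1.
  { apply IZR_le. generalize (expansion_pos b x 0 H); lia. }
  assert (0 < / IZR (b 1%nat) <= 1)%R.
  { split; [apply Rinv_0_lt_compat; lra|].
    rewrite <- Rinv_1. apply Rinv_le_contravar; lra. }
  simpl; split; apply Rabs_le; lra.
- split; [apply IH; exact H|].
  apply Rle_trans with (1 := cf_fin_contract b x k H).
  destruct (IH _ _ (expansion_tail b x 2 H)) as [K _]. simpl in *. lra.
Qed.

Lemma expansion_lim (b : nat -> Z) (x : nat -> R) :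
  expansion b x -> is_lim_seq (cf_fin b) (Finite (x O)).
Proof.
intros H.
apply is_lim_seq_ext with (fun k => (x O + (cf_fin b k - x O))%R); [intros; ring|].
replace (Finite (x O)) with (Finite (x O + 0)) by (f_equal; ring).
apply is_lim_seq_plus'; [apply is_lim_seq_const|].
apply is_lim_seq_abs_0.
apply is_lim_seq_le_le with (fun _ => 0%R) (fun k => (2 * (/ 2) ^ k)%R).
- intros k; split; [apply Rabs_pos|now apply cf_fin_dist].
- apply is_lim_seq_const.
- replace (Finite 0) with (Rbar_mult (Finite 2) (Finite 0)) by (simpl; f_equal; ring).
  apply is_lim_seq_scal_l, is_lim_seq_geom. rewrite Rabs_pos_eq; lra.
Qed.

(** The finite tails stay in [[1, b 1 + 1]], so the limit [l - b 0] of their inverses is at least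
    [1 / (b 1 + 1)]; being nonzero, it may be inverted. *)
Lemma cf_fin_tail_lim (b : nat -> Z) (l : R) :
  (forall i, 0 < b (S i)) ->
  is_lim_seq (cf_fin b) (Finite l) ->
  is_lim_seq (cf_fin (fun i => b (S i))) (Finite (/ (l - IZR (b O)))) /\
  (1 <= / (l - IZR (b O)))%R.
Proof.
intros Hb H.
set (y := cf_fin (fun i => b (S i))).
assert (forall k, 1 <= y k <= IZR (b 1%nat) + 1)%R as Y.
{ intros k; split.
  - apply cf_fin_ge1; intros i; apply Hb.
  - apply (cf_fin_ge (fun i => b (S i)) k); intros i; apply Hb. }
assert (is_lim_seq (fun k => (/ y k)%R) (Finite (l - IZR (b O)))) as I.
{ apply is_lim_seq_ext with (fun k => (cf_fin b (S k) - IZR (b O))%R).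
  - intros k; simpl; fold y; unfold y; ring.
  - apply is_lim_seq_minus'; [now apply -> is_lim_seq_incr_1|apply is_lim_seq_const]. }
assert (/ (IZR (b 1%nat) + 1) <= l - IZR (b O))%R as P.
{ apply (is_lim_seq_le (fun _ => / (IZR (b 1%nat) + 1))%R (fun k => / y k)%R
           (Finite (/ (IZR (b 1%nat) + 1))) (Finite (l - IZR (b O)))).
  - intros k; specialize (Y k). apply Rinv_le_contravar; lra.
  - apply is_lim_seq_const.
  - exact I. }
assert (0 < / (IZR (b 1%nat) + 1))%R as P'.
{ apply Rinv_0_lt_compat. specialize (Y O). lra. }
assert (is_lim_seq y (Finite (/ (l - IZR (b O))))) as J.
{ apply is_lim_seq_ext with (fun k => / (/ y k))%R.
  - intros k; apply Rinv_inv.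
  - apply (is_lim_seq_inv _ (Finite (l - IZR (b O)))); [exact I|].
    intros E; injection E; lra. }
split; [exact J|].
apply (is_lim_seq_le (fun _ => 1%R) y (Finite 1) (Finite (/ (l - IZR (b O))))).
- intros k; apply Y.
- apply is_lim_seq_const.
- exact J.
Qed.

Lemma cf_fin_ext (b b' : nat -> Z) (k : nat) :
  (forall i, b i = b' i) -> cf_fin b k = cf_fin b' k.
Proof.
revert b b'; induction k as [|k IH]; intros b b' H; simpl; rewrite H.
- reflexivity.
- now rewrite (IH (fun i => b (S i)) (fun i => b' (S i)) (fun i => H (S i))).
Qed.

(** Converse of [expansion_lim]. That the complete quotients are themselves limits is kept because
    it transfers periodicity of the terms to periodicity of the [x i]. *)
Lemma lim_expansion (b : nat -> Z) (l : R) :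
  (forall i, 0 < b (S i)) ->
  is_lim_seq (cf_fin b) (Finite l) ->
  exists x, x O = l /\ expansion b x /\
    forall i, is_lim_seq (cf_fin (fun j => b (i + j)%nat)) (Finite (x i)).
Proof.
intros Hb H.
pose (x := fix x i : R := match i with O => l | S j => / (x j - IZR (b j)) end%R).
assert (forall i, is_lim_seq (cf_fin (fun j => b (i + j)%nat)) (Finite (x i)) ->
  is_lim_seq (cf_fin (fun j => b (S i + j)%nat)) (Finite (x (S i))) /\ (1 <= x (S i))%R)
  as step.
{ intros i IH.
  destruct (cf_fin_tail_lim (fun j => b (i + j)%nat) (x i)) as [K L].
  - intros j; rewrite Nat.add_succ_r; apply Hb.
  - exact IH.
  - rewrite Nat.add_0_r in K, L. split; [|exact L].
    apply is_lim_seq_ext with (2 := K).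
    intros k; apply cf_fin_ext; intros j; f_equal; lia. }
assert (forall i, is_lim_seq (cf_fin (fun j => b (i + j)%nat)) (Finite (x i))) as T.
{ induction i as [|i IH]; [exact H|]. now apply step. }
assert (forall i, x i = (IZR (b i) + / x (S i))%R) as E.
{ intros i. change (x (S i)) with (/ (x i - IZR (b i)))%R.
  rewrite Rinv_inv. ring. }
exists x; split; [reflexivity|split; [|exact T]].
intros i; split; [apply E|].
rewrite E. destruct (step (S i) (T (S i))) as [_ L].
assert (0 < / x (S (S i)))%R by (apply Rinv_0_lt_compat; lra).
assert (1 <= IZR (b (S i)))%R by (apply IZR_le; specialize (Hb i); lia).
lra.
Qed.

(** * Units are convergents *)

(** For [k > 0] the first column is the convergent with terms [b 0, ..., b (k - 1)], the second
    column the convergent before it. *)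
Definition convmat (b : nat -> Z) (k : nat) : mat2 := cfmat (map b (List.seq 0 k)).

Lemma convmat_S (b : nat -> Z) (k : nat) :
  convmat b (S k) = mmul (convmat b k) (mstep (b k)).
Proof.
unfold convmat. rewrite seq_S, map_app, cfmat_app.
apply mat2_eq; cbn -[Z.mul Z.add]; ring.
Qed.

Lemma convmat_tail (b : nat -> Z) (k : nat) :
  convmat b (S k) = mmul (mstep (b O)) (convmat (fun i => b (S i)) k).
Proof.
unfold convmat. change (List.seq 0 (S k)) with (O :: List.seq 1 k).
rewrite <- seq_shift. simpl map. rewrite map_map. apply cfmat_cons.
Qed.

Lemma Forall_map_seq (P : Z -> Prop) (b : nat -> Z) (i k : nat) :
  (forall j, (i <= j < i + k)%nat -> P (b j)) -> List.Forall P (map b (List.seq i k)).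
Proof.
intros H. apply Forall_map, Forall_forall.
intros j Hj. apply in_seq in Hj. now apply H.
Qed.

Lemma expansion_convmat (b : nat -> Z) (x : nat -> R) (k : nat) :
  expansion b x ->
  (x O * (IZR (m21 (convmat b k)) * x k + IZR (m22 (convmat b k))) =
   IZR (m11 (convmat b k)) * x k + IZR (m12 (convmat b k)))%R.
Proof.
intros H; induction k as [|k IH]; [simpl; ring|].
rewrite convmat_S. cbn [mmul mstep m11 m12 m21 m22].
destruct (H k) as [E L]. rewrite E in IH.
rewrite !plus_IZR, !mult_IZR.
apply (f_equal (fun y => y * x (S k))%R) in IH.
rewrite Rmult_assoc in IH.
replace ((IZR (m21 (convmat b k)) * (IZR (b k) + / x (S k)) + IZR (m22 (convmat b k))) * x (S k))%R
  with (IZR (m21 (convmat b k)) * IZR (b k) * x (S k) + IZR (m21 (convmat b k))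
        + IZR (m22 (convmat b k)) * x (S k))%R in IH by (field; lra).
replace ((IZR (m11 (convmat b k)) * (IZR (b k) + / x (S k)) + IZR (m12 (convmat b k))) * x (S k))%R
  with (IZR (m11 (convmat b k)) * IZR (b k) * x (S k) + IZR (m11 (convmat b k))
        + IZR (m12 (convmat b k)) * x (S k))%R in IH by (field; lra).
lra.
Qed.

Lemma mdet_convmat_abs (b : nat -> Z) (k : nat) : Z.abs (mdet (convmat b k)) = 1.
Proof.
unfold convmat. rewrite mdet_cfmat. now destruct (Nat.even _).
Qed.

Lemma convmat_bounds (b : nat -> Z) (x : nat -> R) (k : nat) :
  expansion b x -> 0 < b O -> (1 <= k)%nat ->
  1 <= m11 (convmat b k) <= (b O + 1) * m21 (convmat b k) /\
  0 <= m12 (convmat b k) /\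
  1 <= m21 (convmat b k) /\ 0 <= m22 (convmat b k) <= m21 (convmat b k).
Proof.
intros H B Hk. destruct k as [|k]; [lia|].
rewrite convmat_tail.
destruct (cfmat_bounds (map (fun i => b (S i)) (List.seq 0 k))) as (K1 & K2 & K3 & K4 & _).
{ apply Forall_map_seq. intros j _. exact (expansion_pos b x j H). }
fold (convmat (fun i => b (S i)) k) in *.
cbn [mmul mstep m11 m12 m21 m22]. repeat split; nia.
Qed.

Lemma convmat_mono (b : nat -> Z) (x : nat -> R) (k k' : nat) :
  expansion b x -> 0 < b O -> (1 <= k <= k')%nat ->
  m11 (convmat b k) <= m11 (convmat b k') /\ m21 (convmat b k) <= m21 (convmat b k').
Proof.
intros H B [Hk Hk']. induction Hk' as [|k' Hk' IH]; [lia|].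
destruct (convmat_bounds b x k' H B ltac:(lia)) as (K1 & K2 & K3 & K4).
assert (0 < b k') as P.
{ destruct k' as [|k']; [lia|]. exact (expansion_pos b x k' H). }
rewrite convmat_S. cbn [mmul mstep m11 m12 m21 m22]. nia.
Qed.

(** A convergent matrix together with the complete quotient behind it; Euclid's algorithm builds
    such pairs one partial quotient at a time. *)
Definition reaches (b : nat -> Z) (x : nat -> R) (M : mat2) (xi : R) : Prop :=
  exists k, (1 <= k)%nat /\ x k = xi /\ convmat b k = M.

Lemma reaches_one (b : nat -> Z) (x : nat -> R) (p : Z) (xi : R) :
  expansion b x -> (1 < xi)%R -> x O = (IZR p + / xi)%R ->
  reaches b x (Mat2 p 1 1 0) xi.
Proof.
intros H L E. destruct (H O) as [E0 L0].
destruct (digit_unique (b O) p (x 1%nat) xi L0 L ltac:(congruence)) as [E1 E2].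
exists 1%nat; split; [lia|]. split; [exact E2|].
rewrite convmat_S, E1. apply mat2_eq; cbn -[Z.mul Z.add]; ring.
Qed.

Lemma reaches_step (b : nat -> Z) (x : nat -> R) (M : mat2) (e : Z) (xi : R) :
  expansion b x -> (1 < xi)%R -> reaches b x M (IZR e + / xi)%R ->
  reaches b x (mmul M (mstep e)) xi.
Proof.
intros H L (k & Hk & E & <-). destruct (H k) as [E0 L0].
destruct (digit_unique (b k) e (x (S k)) xi L0 L ltac:(congruence)) as [E1 E2].
exists (S k); split; [lia|]. split; [exact E2|]. now rewrite convmat_S, E1.
Qed.

(* Euclid's algorithm on the bottom row; its last quotient [q] is split as
   [q - 1, 1] when the determinant has the wrong sign. *)
Lemma unimodular_reaches (b : nat -> Z) (x : nat -> R) (p p' q q' : Z) (xi : R) :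
  expansion b x -> (1 < xi)%R -> 1 <= q' < q -> Z.abs (p * q' - p' * q) = 1 ->
  (x O * (IZR q * xi + IZR q') = IZR p * xi + IZR p')%R ->
  reaches b x (Mat2 p p' q q') xi.
Proof.
intros H.
remember (Z.to_nat q') as N eqn:HN. assert (Z.to_nat q' <= N)%nat as HN' by lia. clear HN.
revert p p' q q' xi HN'; induction N as [|N IH]; intros p p' q q' xi HN L Hq Hd E; [lia|].
assert (0 < / xi < 1)%R as I by now apply inv_lt_1.
destruct (Z.eq_dec q' 1) as [->|Hq'].
- destruct (Z.eq_dec (p - p' * q) 1) as [Hp|Hp].
  + replace (Mat2 p p' q 1) with (mmul (Mat2 p' 1 1 0) (mstep q))
      by (apply mat2_eq; cbn -[Z.mul Z.add]; lia).
    assert (2 <= IZR q)%R by (apply IZR_le; lia).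
    assert (0 < IZR q * xi)%R by nra.
    apply reaches_step, reaches_one; trivial; [lra|].
    apply Rmult_eq_reg_r with (IZR q * xi + 1)%R; [|lra].
    rewrite E. replace (IZR p) with (IZR p' * IZR q + 1)%R
      by (rewrite <- mult_IZR, <- plus_IZR; f_equal; lia).
    field. lra.
  + assert (p = p' * q - 1) as -> by lia.
    replace (Mat2 (p' * q - 1) p' q 1)
      with (mmul (mmul (Mat2 (p' - 1) 1 1 0) (mstep 1)) (mstep (q - 1)))
      by (apply mat2_eq; cbn -[Z.mul Z.add Z.sub]; ring).
    assert (1 <= IZR (q - 1))%R by (apply IZR_le; lia).
    assert (0 < / (IZR (q - 1) + / xi) < 1)%R by (apply inv_lt_1; lra).
    apply reaches_step; trivial. apply reaches_step, reaches_one; trivial; try lra.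
    apply Rmult_eq_reg_r with (IZR q * xi + 1)%R.
    2:{ rewrite minus_IZR in *; nra. }
    rewrite E, !minus_IZR, mult_IZR in *.
    field. repeat split; nra.
- assert (q = q' * (q / q') + q mod q') as Dv by (apply Z.div_mod; lia).
  assert (0 <= q mod q' < q') as Mb by (apply Z.mod_pos_bound; lia).
  set (e := q / q') in *. set (r := q mod q') in *. clearbody e r.
  assert (1 <= e) as He by nia.
  (* With remainder zero, [q' > 1] would divide the determinant. *)
  assert (r <> 0) as Hr.
  { intros R0. rewrite R0 in Dv.
    assert (Z.abs q' * Z.abs (p - p' * e) = 1) as Ab by (rewrite <- Z.abs_mul, <- Hd; f_equal; rewrite Dv; ring).
    apply Z.eq_mul_1_nonneg in Ab; lia. }
  assert (1 <= IZR e)%R by (apply IZR_le; lia).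
  replace (Mat2 p p' q q') with (mmul (Mat2 p' (p - p' * e) q' r) (mstep e))
    by (apply mat2_eq; cbn -[Z.mul Z.add Z.sub]; lia).
  apply reaches_step; trivial. apply IH.
  + lia.
  + lra.
  + lia.
  + rewrite <- Hd, <- Z.abs_opp. f_equal. rewrite Dv; ring.
  + rewrite Dv in E. rewrite minus_IZR. rewrite plus_IZR in E. rewrite !mult_IZR in *.
    apply Rmult_eq_reg_r with xi; [|lra].
    transitivity (x 0%nat * (((IZR q' * IZR e + IZR r) * xi + IZR q')))%R; [field; lra|].
    rewrite E. field; lra.
Qed.

Lemma sqrt_sq (D : Z) : 0 <= D -> (sqrt (IZR D) * sqrt (IZR D) = IZR D)%R.
Proof. intros H. apply sqrt_def. now apply IZR_le. Qed.

Lemma sqrt_digit_bounds (D : Z) (b : nat -> Z) (x : nat -> R) :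
  0 < D -> expansion b x -> x O = sqrt (IZR D) ->
  0 < b O /\ b O ^ 2 < D < (b O + 1) ^ 2.
Proof.
intros HD H E.
assert (1 <= sqrt (IZR D))%R as L.
{ rewrite <- sqrt_1. apply sqrt_le_1_alt, IZR_le. lia. }
generalize (expansion_bounds b x 0 H) (sqrt_sq D ltac:(lia)). rewrite E.
set (w := sqrt (IZR D)) in *. intros [K1 K2] W.
assert (0 < b O) as B.
{ assert (0 < b O + 1 - 0) as B; [|].
  - apply lt_IZR. rewrite minus_IZR, plus_IZR. lra.
  - assert (b O <> 0); [|lia]. intros Z0. rewrite Z0 in *. lra. }
split; [exact B|].
apply IZR_lt in B.
split; apply lt_IZR; rewrite Z.pow_2_r, mult_IZR, ?plus_IZR; nra.
Qed.

(** Multiplication by [X + Y sqrt D], composed with the translation by [- b 0], gives an integer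
    matrix that sends [sqrt D + b 0] to [sqrt D] and whose determinant is the norm. Euclid's
    algorithm requires [0 < X - b 0 * Y < Y]; the two end points force [Y = 1] and are treated
    directly. *)
Lemma unit_is_convergent (D : Z) (b : nat -> Z) (x : nat -> R) (X Y : Z) :
  0 < D -> expansion b x -> x O = sqrt (IZR D) ->
  0 < X -> 0 < Y -> Z.abs (X ^ 2 - D * Y ^ 2) = 1 ->
  exists k, (1 <= k)%nat /\ x k = (sqrt (IZR D) + IZR (b O))%R /\
    m11 (convmat b k) = X /\ m21 (convmat b k) = Y.
Proof.
intros HD H E HX HY HN.
destruct (sqrt_digit_bounds D b x HD H E) as (B & B1 & B2).
generalize (sqrt_sq D ltac:(lia)) (expansion_bounds b x 0 H). rewrite E.
set (w := sqrt (IZR D)) in *. intros W [W1 _].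
assert (1 <= IZR (b O))%R as B' by (apply IZR_le; lia).
cut (reaches b x (Mat2 X (D * Y - b O * X) Y (X - b O * Y)) (w + IZR (b O))).
{ intros (k & Hk & K1 & K2). exists k. rewrite K2. auto. }
assert (0 <= X - b O * Y <= Y) as R by nia.
assert (w * (IZR Y * (w + IZR (b O)) + IZR (X - b O * Y)) =
  IZR X * (w + IZR (b O)) + IZR (D * Y - b O * X))%R as F.
{ rewrite !minus_IZR, !mult_IZR, <- W. ring. }
destruct (Z.eq_dec (X - b O * Y) 0) as [R0|R0].
- assert (Y = 1) by nia. subst Y.
  assert (X = b O) by lia. subst X.
  replace (D * 1 - b O * b O) with 1 in * by nia.
  rewrite R0 in *.
  apply reaches_one; trivial; [lra|].
  rewrite E. apply Rmult_eq_reg_r with (w + IZR (b O))%R; [|lra].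
  rewrite Rmult_1_l, Rplus_0_r in F. rewrite F. field. lra.
- destruct (Z.eq_dec (X - b O * Y) Y) as [R1|R1].
  + assert (Y = 1) by nia. subst Y.
    assert (X = b O + 1) by lia. subst X.
    assert (D = (b O + 1) ^ 2 - 1) as ED by nia.
    replace (Mat2 _ _ _ _) with (mmul (Mat2 (b O) 1 1 0) (mstep 1))
      by (apply mat2_eq; cbn -[Z.mul Z.add Z.sub Z.pow]; nia).
    apply reaches_step; trivial; [lra|].
    assert (0 < / (w + IZR (b O)))%R by (apply Rinv_0_lt_compat; lra).
    apply reaches_one; trivial; [lra|].
    rewrite E.
    replace (D * 1 - b O * (b O + 1)) with (b O) in F by nia.
    rewrite R1, plus_IZR in F.
    apply Rmult_eq_reg_r with (w + IZR (b O) + 1)%R; [|lra].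
    transitivity (w * (1 * (w + IZR (b O)) + 1))%R; [ring|].
    rewrite F. field. lra.
  + apply unimodular_reaches; trivial.
    * lra.
    * lia.
    * rewrite <- HN. f_equal. ring.
    * rewrite E. exact F.
Qed.

(** * Periodic expansions of square roots *)

Definition unit_norm (D X Y : Z) : Prop := 0 < X /\ 0 < Y /\ Z.abs (X ^ 2 - D * Y ^ 2) = 1.

(** A unit is the convergent at an index where the complete quotient is [sqrt D + b 0]. No such
    index precedes [N], and convergents grow. *)
Lemma unit_norm_minimal (D : Z) (b : nat -> Z) (x : nat -> R) (N : nat) (X Y : Z) :
  0 < D -> expansion b x -> x O = sqrt (IZR D) -> (1 <= N)%nat ->
  (forall i, (1 <= i < N)%nat -> x i <> sqrt (IZR D) + IZR (b O))%R ->
  unit_norm D X Y ->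
  m11 (convmat b N) <= X /\ m21 (convmat b N) <= Y.
Proof.
intros HD H E HN Hx (HX & HY & HU).
destruct (unit_is_convergent D b x X Y HD H E HX HY HU) as (k & K1 & K2 & <- & <-).
apply (convmat_mono b x); trivial.
- apply (sqrt_digit_bounds D b x HD H E).
- split; [exact HN|]. destruct (Nat.le_gt_cases N k) as [L|L]; [exact L|].
  now destruct (Hx k).
Qed.

(* Infinite descent: [(i, j)] is replaced by [(j - s i, i f - s j)] with [s] the
   integer part of [sqrt f]. *)
Lemma nonsquare_mul (f i j : Z) :
  0 < f -> ~ (exists s, f = s ^ 2) -> i ^ 2 * f = j ^ 2 -> i = 0.
Proof.
intros Hf Hs.
destruct (Z.sqrt_spec f ltac:(lia)) as [S1 S2]. set (s := Z.sqrt f) in *.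
assert (0 <= s) as S0 by apply Z.sqrt_nonneg. clearbody s.
assert (s * s <> f) as S3 by (intros E; apply Hs; exists s; lia).
assert (forall n i j, 0 <= i <= Z.of_nat n -> 0 <= j -> i ^ 2 * f = j ^ 2 -> i = 0) as K.
{ clear i j; induction n as [|n IH]; intros i j Hi Hj E; [lia|].
  destruct (Z.eq_dec i 0) as [|I]; [assumption|].
  assert (s * i < j) by nia. assert (j < (s + 1) * i) by nia.
  assert (j - s * i = 0); [|lia].
  apply (IH _ (i * f - s * j)); [lia|nia|].
  transitivity ((j ^ 2 + s ^ 2 * i ^ 2 - 2 * s * i * j) * f); [ring|].
  transitivity ((i ^ 2 * f) * f + s ^ 2 * j ^ 2 - 2 * s * i * j * f); [|ring].
  rewrite E. transitivity (j ^ 2 * f + s ^ 2 * (i ^ 2 * f) - 2 * s * i * j * f); [ring|].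
  rewrite E. ring. }
intros E.
assert (Z.abs i = 0); [|lia].
apply (K (Z.to_nat (Z.abs i)) _ (Z.abs j)); [lia|lia|].
now rewrite !Z.pow_2_r, <- !Z.abs_mul, !Z.abs_eq, <- !Z.pow_2_r by nia.
Qed.

Lemma sqrt_irrational (f i j : Z) :
  0 < f -> ~ (exists s, f = s ^ 2) -> (IZR i * sqrt (IZR f) = IZR j)%R -> i = 0.
Proof.
intros Hf Hs E. apply (nonsquare_mul f i j Hf Hs).
generalize (sqrt_sq f ltac:(lia)). set (w := sqrt (IZR f)) in *. intros W.
apply eq_IZR. rewrite !Z.pow_2_r, !mult_IZR, <- E, <- W. ring.
Qed.

(* The convergent [p/q] before [x k] satisfies [|p - q sqrt f| (q x_k + q') = 1], whereas
   [|p - q sqrt f| (p + q sqrt f) >= 1]; hence [q x_k <= p + q sqrt f]. *)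
Lemma sqrt_quotient_le (f : Z) (b : nat -> Z) (x : nat -> R) (k : nat) :
  0 < f -> ~ (exists s, f = s ^ 2) -> expansion b x -> x O = sqrt (IZR f) -> (1 <= k)%nat ->
  b k <= 2 * b O + 1.
Proof.
intros Hf Hs H E Hk.
destruct (sqrt_digit_bounds f b x Hf H E) as (B & _).
destruct (convmat_bounds b x k H B Hk) as (K1 & K2 & K3 & K4).
generalize (mdet_convmat_abs b k) (expansion_convmat b x k H).
assert (1 < x k)%R as Xk.
{ destruct k as [|k]; [lia|]. apply (H k). }
destruct (convmat b k) as [p p' q q']. unfold mdet. cbn [m11 m12 m21 m22] in *.
intros Hd F.
assert (f * q ^ 2 - p ^ 2 <> 0) as Kn.
{ intros Z0. assert (q = 0); [apply (nonsquare_mul f q p Hf Hs)|]; lia. }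
generalize (expansion_bounds b x k H) (expansion_bounds b x 0 H) (sqrt_sq f ltac:(lia)).
rewrite E in F |- *. set (w := sqrt (IZR f)) in *. intros [W1 _] [W2 _] W.
assert (1 <= IZR p <= (IZR (b O) + 1) * IZR q)%R as P.
{ split; [apply IZR_le; lia|]. rewrite <- plus_IZR, <- mult_IZR. apply IZR_le; lia. }
assert (1 <= IZR q)%R as Q by (apply IZR_le; lia).
assert (0 <= IZR q')%R as Q' by (apply IZR_le; lia).
assert (1 <= IZR (b O))%R as B0 by (apply IZR_le; lia).
assert (Rabs (w * IZR q - IZR p) * (IZR q * x k + IZR q') = 1)%R as A1.
{ rewrite <- (Rabs_pos_eq (IZR q * x k + IZR q')) by nra.
  rewrite <- Rabs_mult, <- (f_equal IZR Hd), abs_IZR, <- Rabs_Ropp. f_equal.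
  rewrite minus_IZR, !mult_IZR.
  transitivity (- (IZR q * (w * (IZR q * x k + IZR q')) - IZR p * (IZR q * x k + IZR q')))%R; [ring|].
  rewrite F. ring. }
assert (1 <= Rabs (w * IZR q - IZR p) * (w * IZR q + IZR p))%R as A2.
{ rewrite <- (Rabs_pos_eq (w * IZR q + IZR p)) by nra.
  rewrite <- Rabs_mult.
  replace ((w * IZR q - IZR p) * (w * IZR q + IZR p))%R with (IZR (f * q ^ 2 - p ^ 2)).
  - rewrite <- abs_IZR. apply IZR_le. lia.
  - rewrite minus_IZR, !Z.pow_2_r, !mult_IZR, <- W. ring. }
assert (0 < Rabs (w * IZR q - IZR p))%R as A3.
{ generalize (Rabs_pos (w * IZR q - IZR p)). intros [L|L]; [exact L|].
  rewrite <- L in A1. lra. }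
assert (IZR q * x k + IZR q' <= w * IZR q + IZR p)%R as A4.
{ apply Rmult_le_reg_l with (1 := A3). lra. }
assert (x k <= w + IZR (b O) + 1)%R as A5.
{ apply Rmult_le_reg_l with (IZR q); [lra|]. lra. }
generalize (expansion_bounds b x 0 H). rewrite E. fold w. intros [_ W3].
assert (b k < 2 * b O + 2); [|lia].
apply lt_IZR. rewrite plus_IZR, mult_IZR. lra.
Qed.

(* [sqrt D = [A0; l, 2 A0, l, 2 A0, ...]] where [M = cfmat l]: the fixed-point equation,
   whose rational and irrational parts are separated. *)
Definition block_eq (D A0 : Z) (M : mat2) : Prop :=
  m12 M = m21 M /\ m11 M * D = A0 ^ 2 * m11 M + 2 * A0 * m21 M + m22 M.

(** For [M = cfmat l] this yields a unit, of norm -1 or 1 according as the length of [l] is even or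
    odd. *)
Lemma block_norm (D A0 : Z) (M : mat2) :
  block_eq D A0 M -> (A0 * m11 M + m21 M) ^ 2 - D * m11 M ^ 2 = - mdet M.
Proof.
intros [H1 H2]. unfold mdet. rewrite H1.
transitivity ((A0 * m11 M + m21 M) ^ 2 - m11 M * (m11 M * D)); [ring|].
rewrite H2. ring.
Qed.

Lemma symmetric_block (f : Z) (b : nat -> Z) (x : nat -> R) (n : nat) :
  0 < f -> ~ (exists s, f = s ^ 2) -> expansion b x -> x O = sqrt (IZR f) ->
  x (S n) = (sqrt (IZR f) + IZR (b O))%R ->
  block_eq f (b O) (cfmat (map (fun i => b (S i)) (List.seq 0 n))).
Proof.
intros Hf Hs H E Ey. set (M := cfmat _). unfold block_eq.
generalize (expansion_convmat b x (S n) H).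
rewrite convmat_tail. change (convmat (fun i => b (S i)) n) with M.
rewrite E, Ey. clearbody M. destruct M as [A B F C]. cbn [mmul mstep m11 m12 m21 m22].
generalize (sqrt_sq f ltac:(lia)). intros W G.
rewrite !plus_IZR, !mult_IZR in G.
(* The coefficient of [sqrt f] is [m12 - m21], so the symmetry of the matrix comes from
   irrationality. *)
assert (IZR (B - F) * sqrt (IZR f) =
  IZR (b O ^ 2 * A + b O * F + b O * B + C - A * f))%R as K.
{ rewrite !minus_IZR, !plus_IZR, Z.pow_2_r, !mult_IZR.
  rewrite <- W at 2. nra. }
assert (B - F = 0) as Z0 by exact (sqrt_irrational f _ _ Hf Hs K).
rewrite Z0, Rmult_0_l in K. apply eq_IZR in K. lia.
Qed.

Lemma periodic_quotients_map (b0 : Z) (block : list Z) (k : nat) :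
  (k <= length block)%nat ->
  map (fun i => periodic_quotients b0 block (S i)) (List.seq 0 k) = firstn k block.
Proof.
intros Hk. apply nth_ext with 0 0.
- rewrite length_map, length_seq, firstn_length_le; auto.
- intros i Hi. rewrite length_map, length_seq in Hi.
  (* The default becomes an image of the mapped function, as [map_nth] requires. *)
  rewrite (nth_indep _ 0 (periodic_quotients b0 block (S 0)))
    by now rewrite length_map, length_seq.
  rewrite (map_nth (fun i => periodic_quotients b0 block (S i))), seq_nth, nth_firstn by lia.
  replace (i <? k)%nat with true by (symmetry; apply Nat.ltb_lt; lia).
  cbn [periodic_quotients Nat.add]. rewrite Nat.mod_small by lia. reflexivity.
Qed.

Lemma convmat_periodic (b0 e : Z) (l : list Z) :
  convmat (periodic_quotients b0 (l ++ [e])) (S (length l)) = mmul (mstep b0) (cfmat l).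
Proof.
rewrite convmat_tail. unfold convmat. rewrite periodic_quotients_map.
- now rewrite firstn_app, Nat.sub_diag, firstn_all, app_nil_r.
- rewrite length_app; lia.
Qed.

Lemma periodic_quotients_pos (b0 : Z) (block : list Z) (i : nat) :
  block <> [] -> List.Forall (fun b => 0 < b) block ->
  0 < periodic_quotients b0 block (S i).
Proof.
intros Hb Hp. rewrite Forall_forall in Hp. apply Hp, nth_In, Nat.mod_upper_bound.
now rewrite length_zero_iff_nil.
Qed.

Definition cf_eval (l : list Z) (y : R) : R :=
  fold_right (fun b r => IZR b + / r)%R y l.

Lemma cf_eval_gt1 (l : list Z) (y : R) :
  List.Forall (fun b => 0 < b) l -> (1 < y)%R -> (1 < cf_eval l y)%R.
Proof.
intros H Hy; induction H as [|b l Hb _ IH]; [exact Hy|].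
simpl. assert (1 <= IZR b)%R by (apply IZR_le; lia). apply inv_lt_1 in IH. lra.
Qed.

Lemma cf_eval_cfmat (l : list Z) (y : R) :
  List.Forall (fun b => 0 < b) l -> (1 < y)%R ->
  (cf_eval l y * (IZR (m21 (cfmat l)) * y + IZR (m22 (cfmat l))) =
   IZR (m11 (cfmat l)) * y + IZR (m12 (cfmat l)))%R.
Proof.
intros H Hy; induction H as [|b l Hb Hl IH]; [simpl; ring|].
generalize (cf_eval_gt1 l y Hl Hy); intros L.
rewrite cfmat_cons. cbn [mmul mstep m11 m12 m21 m22]. cbn [cf_eval fold_right].
fold (cf_eval l y).
rewrite !plus_IZR, !mult_IZR.
transitivity ((IZR b * (IZR (m11 (cfmat l)) * y + IZR (m12 (cfmat l))) +
  / cf_eval l y * (IZR (m11 (cfmat l)) * y + IZR (m12 (cfmat l)))))%R; [ring|].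
rewrite <- IH at 2. field. lra.
Qed.

(** Candidate complete quotients: what is left of the block, followed by [sqrt D + A0]. At the end
    of the block nothing is left, and the value is [sqrt D + A0], whose term is [2 * A0]. *)
Definition periodic_tails (D A0 : Z) (l : list Z) (i : nat) : R :=
  match i with
  | O => sqrt (IZR D)
  | S j => cf_eval (skipn (j mod S (length l)) l) (sqrt (IZR D) + IZR A0)
  end.

(** Inside the block the recurrence holds by construction. The relation at index 0 is [block_eq],
    and adding [A0] to it gives the relation at the term [2 * A0]. *)
Lemma symmetric_expansion (D A0 : Z) (l : list Z) :
  0 < A0 -> List.Forall (fun b => 0 < b) l -> block_eq D A0 (cfmat l) ->
  expansion (periodic_quotients A0 (l ++ [2 * A0])) (periodic_tails D A0 l).
Proof.
intros HA Hl [Hsym HD].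
destruct (cfmat_bounds l Hl) as (K1 & K2 & K3 & K4 & _).
(* Keeps the denominator of the fixed-point equation positive. *)
assert (m21 (cfmat l) <> 0 \/ m22 (cfmat l) <> 0) as K5.
{ generalize (mdet_cfmat l). unfold mdet. destruct (Nat.even _); nia. }
assert (A0 ^ 2 <= D) as D0 by nia.
generalize (cf_eval_cfmat l (sqrt (IZR D) + IZR A0) Hl).
assert (IZR A0 <= sqrt (IZR D))%R as W0.
{ rewrite <- (sqrt_pow2 (IZR A0)) by (apply IZR_le; lia).
  apply sqrt_le_1_alt. rewrite pow_IZR. apply IZR_le. exact D0. }
assert (1 <= IZR A0)%R as A1 by (apply IZR_le; lia).
assert (forall i, 1 < periodic_tails D A0 l (S i))%R as T1.
{ intros i. apply cf_eval_gt1; [|lra].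
  rewrite Forall_forall in *. intros b Hb. apply Hl.
  rewrite <- (firstn_skipn (i mod S (length l)) l). apply in_or_app. now right. }
generalize (sqrt_sq D ltac:(nia)).
intros W F. specialize (F ltac:(lra)).
assert (sqrt (IZR D) = IZR A0 + / cf_eval l (sqrt (IZR D) + IZR A0))%R as E0.
{ generalize (cf_eval_gt1 l (sqrt (IZR D) + IZR A0) Hl ltac:(lra)). intros L.
  set (z := cf_eval l _) in *.
  apply (f_equal IZR) in HD. rewrite !plus_IZR, Z.pow_2_r, !mult_IZR, <- W in HD.
  rewrite Hsym in F.
  set (A := IZR (m11 (cfmat l))) in *. set (B := IZR (m21 (cfmat l))) in *.
  set (C := IZR (m22 (cfmat l))) in *. set (w := sqrt (IZR D)) in *.
  assert (0 <= B)%R as B0 by (apply IZR_le; lia).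
  assert (0 <= C)%R as C0 by (apply IZR_le; lia).
  assert (0 < B * (w + IZR A0) + C)%R as P.
  { destruct K5 as [K5|K5].
    - assert (0 < B)%R by (apply IZR_lt; lia). nra.
    - assert (0 < C)%R by (apply IZR_lt; lia). nra. }
  apply Rmult_eq_reg_r with (z * (B * (w + IZR A0) + C))%R; [|nra].
  rewrite Rmult_plus_distr_r.
  replace (/ z * (z * (B * (w + IZR A0) + C)))%R with (B * (w + IZR A0) + C)%R by (field; lra).
  rewrite F. nra. }
intros i. split; [|apply T1].
destruct i as [|j].
{ cbn [periodic_tails periodic_quotients]. now rewrite Nat.Div0.mod_0_l. }
set (N := S (length l)).
assert (length (l ++ [2 * A0]) = N) as LN by (rewrite length_app; unfold N; simpl; lia).
cbn [periodic_quotients periodic_tails]. rewrite LN. fold N.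
assert (j mod N < N)%nat as Hr by (apply Nat.mod_upper_bound; discriminate).
generalize (Nat.div_mod j N ltac:(discriminate)). intros Dv.
destruct (Nat.eq_dec (j mod N) (length l)) as [Er|Er].
- replace (S j mod N)%nat with 0%nat
    by (apply Nat.mod_unique with (S (j / N)); unfold N in *; nia).
  rewrite Er, skipn_all, app_nth2, Nat.sub_diag by lia.
  cbn [skipn nth cf_eval fold_right]. fold (cf_eval l (sqrt (IZR D) + IZR A0)).
  rewrite mult_IZR. lra.
- replace (S j mod N)%nat with (S (j mod N))
    by (apply Nat.mod_unique with (j / N)%nat; unfold N in *; nia).
  assert (j mod N < length l)%nat as Hr' by (unfold N in *; lia).
  rewrite app_nth1 by exact Hr'. clear - Hr'.
  revert Hr'. generalize (j mod N)%nat. intros r.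
  revert r; induction l as [|b l IH]; intros [|r] Hr; simpl in Hr; try lia.
  + reflexivity.
  + apply (IH r). lia.
Qed.

Lemma symmetric_periodic_cf (D A0 : Z) (l : list Z) :
  0 < A0 -> List.Forall (fun b => 0 < b) l -> block_eq D A0 (cfmat l) ->
  is_periodic_cf (sqrt (IZR D)) A0 (l ++ [2 * A0]).
Proof.
intros HA Hl HD. split; [|split].
- intros E. now apply app_eq_nil in E.
- apply Forall_app; split; [exact Hl|]. constructor; [lia|constructor].
- exact (expansion_lim _ _ (symmetric_expansion D A0 l HA Hl HD)).
Qed.

(** A complete quotient [sqrt D + A0] has integer part at least [2 * A0], which no term of [l]
    reaches. The size of the terms thus takes the place of minimality of the period. *)
Lemma symmetric_unit_minimal (D A0 : Z) (l : list Z) (X Y : Z) :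
  0 < A0 -> List.Forall (fun b => 0 < b < 2 * A0) l -> block_eq D A0 (cfmat l) ->
  unit_norm D X Y ->
  A0 * m11 (cfmat l) + m21 (cfmat l) <= X /\ m11 (cfmat l) <= Y.
Proof.
intros HA Hl' HD HU.
assert (List.Forall (fun b => 0 < b) l) as Hl
  by (revert Hl'; apply Forall_impl; lia).
generalize (symmetric_expansion D A0 l HA Hl HD). intros H.
destruct HD as [Hsym HD].
destruct (cfmat_bounds l Hl) as (K1 & K2 & K3 & K4 & _).
generalize (convmat_periodic A0 (2 * A0) l). intros EM.
cut (m11 (convmat (periodic_quotients A0 (l ++ [2 * A0])) (S (length l))) <= X /\
  m21 (convmat (periodic_quotients A0 (l ++ [2 * A0])) (S (length l))) <= Y).
{ rewrite EM. cbn [mmul mstep m11 m12 m21 m22]. lia. }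
apply (unit_norm_minimal D _ _ _ X Y ltac:(nia) H eq_refl); [lia| |exact HU].
intros i Hi Ei.
generalize (expansion_bounds _ _ i H) (expansion_bounds _ _ 0%nat H).
rewrite Ei. cbn [periodic_tails]. destruct i as [|i]; [lia|].
cbn [periodic_quotients].
rewrite Nat.mod_small, app_nth1 by (rewrite ?length_app; simpl; lia).
intros [_ L1] [L2 _].
assert (nth i l 0 < 2 * A0) as L3.
{ rewrite Forall_forall in Hl'. apply Hl', nth_In. lia. }
assert (2 * A0 < nth i l 0 + 1); [|lia].
apply lt_IZR. rewrite plus_IZR, mult_IZR. lra.
Qed.

(** * Fundamental solutions *)

Lemma fundamental_unique (D X Y X' Y' : Z) :
  is_fundamental_solution D X Y -> is_fundamental_solution D X' Y' -> X = X' /\ Y = Y'.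
Proof.
intros ((H1 & H2 & H3) & H) ((H1' & H2' & H3') & H').
destruct (H X' Y' H1' H2' H3'), (H' X Y H1 H2 H3). lia.
Qed.

Lemma fundamental_of_norm_1 (D P Q : Z) :
  0 < P -> 0 < Q -> P ^ 2 - D * Q ^ 2 = 1 ->
  (forall X Y, unit_norm D X Y -> P <= X /\ Q <= Y) ->
  is_fundamental_solution D P Q.
Proof.
intros HP HQ HN Hmin. split; [auto|].
intros X Y HX HY HXY. apply Hmin. unfold unit_norm. now rewrite HXY.
Qed.

Lemma lt_of_sqr_lt (i j : Z) : 0 <= j -> i ^ 2 < j ^ 2 -> i < j.
Proof. nia. Qed.

(* Dividing a unit of norm 1 by the minimal unit [P + Q sqrt D] leaves a positive unit of
   norm -1, which is again at least [P + Q sqrt D]. *)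
Lemma fundamental_of_norm_neg1 (D P Q : Z) :
  0 < D -> 0 < P -> 0 < Q -> P ^ 2 - D * Q ^ 2 = -1 ->
  (forall X Y, unit_norm D X Y -> P <= X /\ Q <= Y) ->
  is_fundamental_solution D (2 * P ^ 2 + 1) (2 * P * Q).
Proof.
intros HD HP HQ HN Hmin. split.
- split; [nia|split; [nia|]].
  transitivity (1 + 4 * P ^ 2 * (P ^ 2 - D * Q ^ 2 + 1)); [ring|]. rewrite HN. ring.
- intros X Y HX HY HXY.
  destruct (Hmin X Y) as [M1 M2]; [unfold unit_norm; rewrite HXY; auto|].
  (* [x + y sqrt D] is the quotient of [X + Y sqrt D] by [P + Q sqrt D]: the inverse of a unit of
     norm -1 is minus its conjugate. *)
  remember (D * Q * Y - P * X) as x eqn:Ex. remember (Q * X - P * Y) as y eqn:Ey.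
  assert (x ^ 2 - D * y ^ 2 = -1) as N.
  { transitivity ((P ^ 2 - D * Q ^ 2) * (X ^ 2 - D * Y ^ 2)); [rewrite Ex, Ey; ring|].
    now rewrite HN, HXY. }
  (* Both signs are found by comparing squares; for [x] this uses [Q <= Y]. *)
  assert ((Q * X) ^ 2 - (P * Y) ^ 2 = Q ^ 2 + Y ^ 2) as Ny.
  { transitivity (Q ^ 2 * (X ^ 2 - D * Y ^ 2) - (P ^ 2 - D * Q ^ 2) * Y ^ 2); [ring|].
    rewrite HN, HXY. ring. }
  assert ((D * Q * Y) ^ 2 - (P * X) ^ 2 = D * (Y ^ 2 - Q ^ 2) + 1) as Nx.
  { transitivity (- P ^ 2 * (X ^ 2 - D * Y ^ 2) - D * Y ^ 2 * (P ^ 2 - D * Q ^ 2)); [ring|].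
    rewrite HXY, HN. replace (P ^ 2) with (D * Q ^ 2 - 1) by lia. ring. }
  assert (0 < y) as Py.
  { rewrite Ey. apply Z.lt_0_sub. apply lt_of_sqr_lt; [apply Z.mul_nonneg_nonneg; lia|].
    apply Z.lt_0_sub. rewrite Ny. apply Z.add_pos_pos; apply Z.pow_pos_nonneg; lia. }
  assert (0 < x) as Px.
  { rewrite Ex. apply Z.lt_0_sub.
    assert (Q ^ 2 <= Y ^ 2) by (apply Z.pow_le_mono_l; lia).
    apply lt_of_sqr_lt; [repeat apply Z.mul_nonneg_nonneg; lia|].
    apply Z.lt_0_sub. rewrite Nx. apply Z.add_nonneg_pos; [|lia].
    apply Z.mul_nonneg_nonneg; lia. }
  destruct (Hmin x y) as [M3 M4]; [unfold unit_norm; rewrite N; auto|].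
  assert (X = P * x + D * Q * y) as EX.
  { transitivity (- (P ^ 2 - D * Q ^ 2) * X); [rewrite HN; ring|rewrite Ex, Ey; ring]. }
  assert (Y = P * y + Q * x) as EY.
  { transitivity (- (P ^ 2 - D * Q ^ 2) * Y); [rewrite HN; ring|rewrite Ex, Ey; ring]. }
  assert (P * P <= P * x) by (apply Z.mul_le_mono_nonneg_l; lia).
  assert (D * Q * Q <= D * Q * y) by (apply Z.mul_le_mono_nonneg_l; [apply Z.mul_nonneg_nonneg; lia|lia]).
  assert (P * Q <= P * y) by (apply Z.mul_le_mono_nonneg_l; lia).
  assert (Q * P <= Q * x) by (apply Z.mul_le_mono_nonneg_l; lia).
  clear - EX EY H H0 H1 H2 HN. split; lia.
Qed.

(** A block of even length gives a unit of norm -1, which has to be squared. *)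
Lemma block_fundamental (D A0 : Z) (l : list Z) :
  0 < A0 -> List.Forall (fun b => 0 < b < 2 * A0) l -> block_eq D A0 (cfmat l) ->
  let P := A0 * m11 (cfmat l) + m21 (cfmat l) in
  let Q := m11 (cfmat l) in
  if Nat.even (length l) then is_fundamental_solution D (2 * P ^ 2 + 1) (2 * P * Q)
  else is_fundamental_solution D P Q.
Proof.
intros HA Hl HD P Q.
assert (forall X Y, unit_norm D X Y -> P <= X /\ Q <= Y) as Hmin
  by (intros X Y; now apply symmetric_unit_minimal).
generalize (block_norm D A0 (cfmat l) HD). rewrite mdet_cfmat. fold P Q.
destruct (cfmat_bounds l) as (K1 & _ & K3 & K4 & _).
{ revert Hl; apply Forall_impl; lia. }
fold Q in K1, K3. assert (0 < P) by (unfold P; fold Q; nia).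
destruct HD as [_ HD]. fold Q in HD. assert (0 < D) by nia.
destruct (Nat.even (length l)); intros HN.
- apply fundamental_of_norm_neg1; auto; lia.
- apply fundamental_of_norm_1; auto; lia.
Qed.

Lemma length_quotients_upto (a : nat -> Z) (k : nat) : length (quotients_upto a k) = k.
Proof. unfold quotients_upto. now rewrite length_map, length_seq. Qed.

Lemma is_period_of_tail (b0 : Z) (block : list Z) (x : nat -> R) (i : nat) :
  (1 <= i)%nat -> expansion (periodic_quotients b0 block) x ->
  x (S i) = x 1%nat -> is_period b0 block i.
Proof.
intros Hi H E. split; [lia|]. intros j Hj.
destruct (expansion_unique _ _ _ _ (expansion_tail _ x (S i) H) (expansion_S _ x H)) with (j - 1)%nat
  as [K _].
- now rewrite Nat.add_0_r.
- replace (S i + (j - 1))%nat with (j + i)%nat in K by lia.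
  now replace (S (j - 1)) with j in K by lia.
Qed.

Lemma sqrt_expansion_block (f : Z) (n : nat) (a : nat -> Z) :
  0 < f -> ~ (exists s, f = s ^ 2) -> sqrt_expansion f n a ->
  let l := quotients_upto a n in
  let P := a O * m11 (cfmat l) + m21 (cfmat l) in
  let Q := m11 (cfmat l) in
  0 < a O /\ a O ^ 2 < f < (a O + 1) ^ 2 /\
  List.Forall (fun b => 0 < b <= 2 * a O + 1) l /\
  block_eq f (a O) (cfmat l) /\
  forall X Y, unit_norm f X Y -> P <= X /\ Q <= Y.
Proof.
intros Hf Hs [(Hne & Hpos & Hlim) Hleast] l P Q. fold l in Hne, Hpos, Hlim, Hleast.
assert (length l = n) as Ll by apply length_quotients_upto.
set (b := periodic_quotients (a O) (l ++ [2 * a O])) in *.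
destruct (lim_expansion b (sqrt (IZR f))) as (x & E0 & H & T); [|exact Hlim|].
{ intros i. now apply periodic_quotients_pos. }
destruct (sqrt_digit_bounds f b x Hf H E0) as (B1 & B2). change (b O) with (a O) in *.
assert (length (l ++ [2 * a O]) = S n) as Lb by (rewrite length_app; simpl; lia).
assert (map (fun i => b (S i)) (List.seq 0 n) = l) as Em.
{ unfold b. rewrite periodic_quotients_map by lia.
  now rewrite firstn_app, Ll, Nat.sub_diag, <- Ll, firstn_all, app_nil_r. }
assert (x (S n) = (sqrt (IZR f) + IZR (a O))%R) as En.
(* Both are limits of the same continued fraction, since the terms have period [S n]. *)
{ assert (x (S (S n)) = x 1%nat) as E1.
  { generalize (is_lim_seq_unique _ _ (T 1%nat)) (is_lim_seq_unique _ _ (T (S (S n)))).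
    rewrite (Lim_seq_ext (cf_fin (fun j => b (S (S n) + j)%nat)) (cf_fin (fun j => b (1 + j)%nat))).
    - intros -> E; injection E; auto.
    - intros k. apply cf_fin_ext. intros i.
      cbn [Nat.add b periodic_quotients]. f_equal. rewrite Lb.
      symmetry. apply Nat.mod_unique with (S (i / S n)).
      + apply Nat.mod_upper_bound; discriminate.
      + generalize (Nat.div_mod i (S n) ltac:(discriminate)). lia. }
  destruct (H (S n)) as [-> _]. destruct (H O) as [E2 _]. rewrite E1, <- E0, E2.
  change (b O) with (a O).
  replace (b (S n)) with (2 * a O).
  - rewrite mult_IZR. ring.
  - cbn [b periodic_quotients]. rewrite Nat.mod_small by lia.
    rewrite app_nth2, Ll, Nat.sub_diag by lia. reflexivity. }
split; [exact B1|]. split; [exact B2|]. split; [|split].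
- rewrite <- Em. apply Forall_map_seq. intros j _. split.
  + exact (expansion_pos b x j H).
  + apply (sqrt_quotient_le f b x (S j) Hf Hs H E0). lia.
- rewrite <- Em. exact (symmetric_block f b x n Hf Hs H E0 En).
- intros X Y HU.
  destruct (unit_norm_minimal f b x (S n) X Y Hf H E0 ltac:(lia)) as [M1 M2]; [|exact HU|].
  + intros i Hi Ei. change (b O) with (a O) in Ei.
    rewrite <- En in Ei.
    (* If [x i = sqrt f + a 0], the next complete quotient is [x 1], so [i] is a period. *)
    assert (S n <= i)%nat; [|lia]. rewrite <- Lb. apply Hleast.
    apply is_period_of_tail with x; [lia|exact H|].
    destruct (H i) as [E1 L1]. destruct (H O) as [E2 L2].
    apply (digit_unique (b i) (2 * a O)); trivial.
    rewrite <- E1, Ei, En, <- E0, E2, mult_IZR. change (b O) with (a O). ring.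
  + revert M1 M2. unfold b. rewrite <- Ll, convmat_periodic.
    cbn [mmul mstep m11 m12 m21 m22]. unfold P, Q. lia.
Qed.

Lemma sqrt_expansion_fundamental (f c h : Z) (n : nat) (a : nat -> Z) :
  0 < f -> ~ (exists s, f = s ^ 2) -> sqrt_expansion f n a ->
  is_fundamental_solution f c h ->
  let M := cfmat (quotients_upto a n) in
  let P := a O * m11 M + m21 M in
  let Q := m11 M in
  if Nat.even n then c = 2 * P ^ 2 + 1 /\ h = 2 * P * Q else c = P /\ h = Q.
Proof.
intros Hf Hs Hcf Hch M P Q.
destruct (sqrt_expansion_block f n a Hf Hs Hcf) as (B1 & B2 & Hl & HD & Hmin).
generalize (block_norm f _ _ HD). rewrite mdet_cfmat, length_quotients_upto. fold M in HD, Hmin |- *. fold P Q in Hmin |- *.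
destruct (cfmat_bounds (quotients_upto a n)) as (K1 & _ & K3 & K4 & _).
{ revert Hl; apply Forall_impl; lia. }
fold M in K1, K3. fold Q in K1, K3. assert (0 < P) by (unfold P; fold Q; nia).
destruct (Nat.even n); intros HN; apply (fundamental_unique f); trivial.
- apply fundamental_of_norm_neg1; auto; lia.
- apply fundamental_of_norm_1; auto; lia.
Qed.

(** Serves [f = 8], where [c = 3], [h = 1] and [f_t 8 3 1 t = 4 (t + 1)^2 + 4]. *)
Lemma fundamental_4sq (k : Z) :
  0 < k -> is_fundamental_solution (4 * k ^ 2 + 4) (2 * k ^ 2 + 1) (k).
Proof.
intros Hk.
generalize (block_fundamental (4 * k ^ 2 + 4) (2 * k) [k]). cbn -[Z.mul Z.add Z.pow].
replace (2 * k * (k * 1 + 1 * 0) + (1 * 1 + 0 * 0)) with (2 * k ^ 2 + 1) by ring.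
replace (k * 1 + 1 * 0) with (k) by ring.
intros K; apply K; [lia| |].
- constructor; [lia|constructor].
- split; cbn -[Z.mul Z.add Z.pow]; ring.
Qed.

(** Serves [f = 12], where [c = 7], [h = 2] and [f_t 12 7 2 t = 9 (4 t + 1)^2 + 3]. *)
Lemma fundamental_9sq (k : Z) :
  0 < k -> is_fundamental_solution (9 * k ^ 2 + 3) (6 * k ^ 2 + 1) (2 * k).
Proof.
intros Hk.
generalize (block_fundamental (9 * k ^ 2 + 3) (3 * k) [2 * k]). cbn -[Z.mul Z.add Z.pow].
replace (3 * k * (2 * k * 1 + 1 * 0) + (1 * 1 + 0 * 0)) with (6 * k ^ 2 + 1) by ring.
replace (2 * k * 1 + 1 * 0) with (2 * k) by ring.
intros K; apply K; [lia| |].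
- constructor; [lia|constructor].
- split; cbn -[Z.mul Z.add Z.pow]; ring.
Qed.

(** * The shifted period *)

Lemma cfmat_palindrome (a : nat -> Z) (m : nat) (x : Z) :
  let L := cfmat (quotients_upto a (m - 1)) in
  cfmat (palindrome a m x) = mmul L (mmul (mstep x) (mtr L)).
Proof.
intros L. unfold palindrome. rewrite !cfmat_app, cfmat_rev. fold L.
apply mat2_eq; cbn -[Z.mul Z.add]; ring.
Qed.

(** Excludes [15 u^2 - p^2 = 3] in the study of the middle quotient. *)
Lemma mod5_square (p : Z) : (p ^ 2) mod 5 <> 2.
Proof.
rewrite Z.pow_2_r, Z.mul_mod by lia.
assert (0 <= p mod 5 < 5) by (apply Z.mod_pos_bound; lia).
assert (p mod 5 = 0 \/ p mod 5 = 1 \/ p mod 5 = 2 \/ p mod 5 = 3 \/ p mod 5 = 4) as K by lia.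
destruct K as [->|[->|[->|[->| ->]]]]; discriminate.
Qed.

(* The middle complete quotient of the period is [(P + sqrt f) / Q] with
   [P = p p' - f u v] and [Q = f u^2 - p^2]. *)
Lemma middle_quotient_two (f a0 am u v w z : Z) :
  0 < a0 -> a0 ^ 2 < f < (a0 + 1) ^ 2 -> 0 < am -> am = a0 \/ am = a0 - 1 ->
  1 <= u -> 0 <= v <= u -> 0 <= w -> 0 <= z -> (w = 0 -> v = 0) -> u * z - v * w = 1 ->
  let p := a0 * u + w in
  let p' := a0 * v + z in
  f * u * (u * am + 2 * v) = p * (p * am + 2 * p') ->
  f = 8 \/ f = 12 \/ p ^ 2 - f * u ^ 2 = -2 /\ u * am + 2 * v = p /\ p * am + 2 * p' = u * f.
Proof.
intros Ha Hf Ham Hor Hu Hv Hw Hz Hwv Hdet p p' HS.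
assert (p' * u - p * v = 1) as Hd by (unfold p, p'; lia).
assert (a0 * u <= p) as Hp by (unfold p; lia).
assert (p = a0 * u -> v = 0) as Hp0 by (unfold p; lia).
assert (0 <= p') as Hp' by (unfold p'; nia).
clearbody p p'. clear Hwv Hdet Hw Hz w z.
remember (f * u ^ 2 - p ^ 2) as Q eqn:EQ. remember (p * p' - f * u * v) as P eqn:EP.
remember (u * am + 2 * v) as T eqn:ET. remember (p * am + 2 * p') as S eqn:ES.
(* [HS] now reads [f u T = p S]. Together with the determinant it gives [Q T = 2 p] and
   [Q am = 2 P]. *)
assert (u * S - p * T = 2) as HST.
{ rewrite ES, ET. transitivity (2 * (p' * u - p * v)); [ring|]. rewrite Hd. ring. }
assert (Q * T = 2 * p) as HQT.
{ rewrite EQ. transitivity (u * (f * u * T) - p * (p * T)); [ring|].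
  rewrite HS. transitivity (p * (u * S - p * T)); [ring|]. rewrite HST. ring. }
assert (Q * am = 2 * P) as HQP.
{ apply Z.mul_reg_l with u; [lia|].
  transitivity (Q * T - 2 * Q * v); [rewrite ET; ring|]. rewrite HQT, EP, EQ.
  transitivity (2 * p * (p' * u) - 2 * f * u ^ 2 * v); [|ring].
  replace (p' * u) with (1 + p * v) by lia. ring. }
assert (f - P ^ 2 = Q * (p' ^ 2 - f * v ^ 2)) as HfP.
{ rewrite EP, EQ. transitivity (f * (p' * u - p * v) ^ 2 - (p * p' - f * u * v) ^ 2); [|ring].
  rewrite Hd. ring. }
assert (0 < a0 * u) as P0 by (apply Z.mul_pos_pos; lia).
assert (0 < p) as Pp by lia.
assert (0 < T) as PT by (rewrite ET; apply Z.add_pos_nonneg; [apply Z.mul_pos_pos|]; lia).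
assert (0 < Q) as PQ.
{ apply Z.mul_pos_cancel_r with T; lia. }
assert (p < (a0 + 1) * u) as Pu.
{ apply lt_of_sqr_lt; [apply Z.mul_nonneg_nonneg; lia|]. rewrite Z.pow_mul_l.
  apply Z.lt_trans with (f * u ^ 2); [apply Z.lt_0_sub; now rewrite <- EQ|].
  apply Z.mul_lt_mono_pos_r; [apply Z.pow_pos_nonneg|]; lia. }
(* [P u + Q v = p < (a0 + 1) u]. *)
assert (P <= a0) as Pa.
{ assert (0 <= Q * v) by (apply Z.mul_nonneg_nonneg; lia).
  assert (p = P * u + Q * v).
  { apply Z.mul_reg_l with 2; [lia|]. rewrite <- HQT, ET.
    transitivity (u * (Q * am) + 2 * (Q * v)); [ring|]. rewrite HQP. ring. }
  assert (P * u < (a0 + 1) * u) as K by (clear - H H0 Pu; lia).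
  apply Z.mul_lt_mono_pos_r in K; lia. }
assert (1 <= P) as P1.
{ assert (0 < Q * am) by (apply Z.mul_pos_pos; lia). clear - H HQP. lia. }
assert (Q = 1 \/ Q = 2 \/ 3 <= Q) as [EQ1|[EQ2|EQ3]] by lia.
(* Here [am = 2 P >= 2] and [2 p = u am + 2 v]. Against [p >= a0 u] and [v <= u] this leaves at most
   [p = a0 u] with [v = u], which [Hp0] forbids. *)
- exfalso. rewrite EQ1, Z.mul_1_l in *. rewrite HQT in ET.
  destruct Hor as [->| ->]; clear - ET HQP P1 Hp Hp0 Hu Hv Ham.
  + assert (2 * u <= a0 * u) by (apply Z.mul_le_mono_nonneg_r; lia). lia.
  + assert (2 * u <= (a0 + 1) * u) by (apply Z.mul_le_mono_nonneg_r; lia).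
    assert (1 * u < a0 * u) by (apply Z.mul_lt_mono_pos_r; lia). lia.
- right; right. rewrite EQ2 in *.
  assert (T = p) as Tp by (clear - HQT; lia). rewrite Tp in *.
  split; [clear - EQ; lia|]. split; [reflexivity|].
  apply Z.mul_reg_l with p; [clear - Pp; lia|]. rewrite <- HS. ring.
(* From [Q am = 2 P <= 2 a0] follow [am = a0 - 1] and [a0 <= 3]. Then [(P, Q)] is [(2, 4)] or
   [(3, 3)], and divisibility of [f - P^2] by [Q] leaves [f = 8], [12] or [15]. *)
- clear - Hf Hor HQP EQ EQ3 Pa HfP Ha Ham.
  assert (am = a0 - 1) as Ea.
  { destruct Hor as [Eam|Eam]; [|exact Eam]. rewrite Eam in *.
    assert (3 * a0 <= Q * a0) by (apply Z.mul_le_mono_nonneg_r; lia). lia. }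
  rewrite Ea in *.
  assert (3 * (a0 - 1) <= Q * (a0 - 1)) by (apply Z.mul_le_mono_nonneg_r; lia).
  assert (a0 = 2 \/ a0 = 3) as Ha0 by lia.
  clear Hor Ea am. destruct Ha0 as [->| ->].
  + left. assert (P = 2) as EP by lia. assert (Q = 4) as EQ4 by lia. rewrite EP, EQ4 in *. lia.
  + right; left.
    assert (Q = 3) as EQ' by lia. assert (P = 3) as EP by lia. rewrite EP, EQ' in *.
    assert (f = 12 \/ f = 15) as [?|?] by lia; [assumption|]. exfalso.
    apply (mod5_square p). replace (p ^ 2) with (2 + (3 * u ^ 2 - 1) * 5) by lia.
    now rewrite Z.mod_add by lia.
Qed.

(** With [u = m11 L], [v = m12 L], [T = u am + 2 v] and [S = p am + 2 p'], the block equation of a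
    palindrome becomes [u T D = p S], and the unit of the block is [(p T + 1, u T)]. *)
Lemma block_eq_palindrome (D A0 am : Z) (L : mat2) :
  mdet L = 1 ->
  let p := A0 * m11 L + m21 L in
  let p' := A0 * m12 L + m22 L in
  let M := mmul L (mmul (mstep am) (mtr L)) in
  m12 M = m21 M /\
  m11 M = m11 L * (m11 L * am + 2 * m12 L) /\
  A0 * m11 M + m21 M = p * (m11 L * am + 2 * m12 L) + 1 /\
  A0 ^ 2 * m11 M + 2 * A0 * m21 M + m22 M = p * (p * am + 2 * p').
Proof.
intros Hd p p' M. rewrite <- Hd. unfold p, p', M, mdet. cbn [mmul mtr mstep m11 m12 m21 m22].
repeat split; ring.
Qed.

(** With [s = (c - 1) h t], the increment [s^2 + 2 s p / q] is [f_t f c h t - f], because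
    [s p / q = 4 p^4 t = (c - 1)^2 t]. *)
Lemma even_shift (f a0 t : Z) (M : mat2) :
  block_eq f a0 M ->
  let p := a0 * m11 M + m21 M in
  let q := m11 M in
  let c := 2 * p ^ 2 + 1 in
  let h := 2 * p * q in
  block_eq (f_t f c h t) ((c - 1) * h * t + a0) M.
Proof.
intros [H1 H2] p q c h. split; [exact H1|]. unfold f_t.
transitivity (m11 M * f + (m11 M * (c - 1) ^ 2 * h ^ 2 * t ^ 2 + 2 * m11 M * (c - 1) ^ 2 * t)); [ring|].
rewrite H2. unfold c, h, p, q. ring.
Qed.

(** Put [u = m11 L]. Shifting [a0] and [am] by [s] turns both [p] and [u am + 2 m12 L] into
    [p + s u], so their equality persists, and the radicand becomes [f + 2 s p / u + s^2]. Since
    [s = p^3 u t], this is [f_t f c h t]. *)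
Lemma odd_shift (f a0 am t : Z) (L : mat2) :
  mdet L = 1 ->
  let p := a0 * m11 L + m21 L in
  let p' := a0 * m12 L + m22 L in
  let c := p ^ 2 + 1 in
  let h := p * m11 L in
  let s := (c - 1) * h * t in
  m11 L * am + 2 * m12 L = p -> p * am + 2 * p' = m11 L * f ->
  let M := mmul L (mmul (mstep (s + am)) (mtr L)) in
  block_eq (f_t f c h t) (s + a0) M /\
  m11 M = h ^ 3 * t + h /\
  (s + a0) * m11 M + m21 M = (c - 1) * h ^ 4 * t ^ 2 + 2 * (c - 1) * h ^ 2 * t + c.
Proof.
intros Hd p p' c h s HT HS M.
destruct (block_eq_palindrome (f_t f c h t) (s + a0) (s + am) L Hd) as (E1 & E2 & E3 & E4).
fold M in E1, E2, E3, E4.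
replace (m11 L * (s + am) + 2 * m12 L) with (p + s * m11 L) in * by lia.
replace ((s + a0) * m11 L + m21 L) with (p + s * m11 L) in * by (unfold p; ring).
replace ((p + s * m11 L) * (s + am) + 2 * ((s + a0) * m12 L + m22 L))
  with (m11 L * f + 2 * s * p + s ^ 2 * m11 L) in E4.
2:{ rewrite <- HS. transitivity (p * am + 2 * p' + s * p + s * p + s ^ 2 * m11 L); [ring|].
    rewrite <- HT at 2. unfold p'. ring. }
assert (s = p ^ 3 * m11 L * t) as Es by (unfold s, c, h; ring).
split; [split|split].
- exact E1.
- rewrite E4, E2, Es. unfold f_t, c, h. ring.
- rewrite E2, Es. unfold h. ring.
- rewrite E3, Es. unfold c, h. ring.
Qed.

Lemma Forall_palindrome (P : Z -> Prop) (a : nat -> Z) (m : nat) (x : Z) :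
  List.Forall P (palindrome a m x) <-> List.Forall P (quotients_upto a (m - 1)) /\ P x.
Proof.
unfold palindrome. rewrite !Forall_app. split.
- intros (H1 & H2 & _). apply Forall_inv in H2. now split.
- intros (H1 & H2). repeat split; auto. now apply Forall_rev.
Qed.

Lemma even_length_palindrome (a : nat -> Z) (m : nat) (x : Z) :
  Nat.even (length (palindrome a m x)) = false.
Proof.
unfold palindrome. rewrite !length_app, length_rev, length_quotients_upto.
rewrite Nat.even_add. change (length [x] + (m - 1))%nat with (S (m - 1)). rewrite Nat.even_succ, <- Nat.negb_even.
now destruct (Nat.even (m - 1)).
Qed.

(** The block has odd length, so its unit [(p T + 1, u T)] is [(c, h)] itself, with [u = m11 L] and
    [T = u * a m + 2 * m12 L]; the middle quotient has denominator 2, which means [T = p]. *)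
Lemma odd_case_unit (f c h : Z) (n m : nat) (a : nat -> Z) :
  0 < f -> ~ (exists s, f = s ^ 2) -> sqrt_expansion f n a ->
  is_fundamental_solution f c h -> odd_case n m a -> f <> 8 /\ f <> 12 ->
  let L := cfmat (quotients_upto a (m - 1)) in
  let p := a O * m11 L + m21 L in
  let p' := a O * m12 L + m22 L in
  mdet L = 1 /\ c = p ^ 2 + 1 /\ h = p * m11 L /\
  m11 L * a m + 2 * m12 L = p /\ p * a m + 2 * p' = m11 L * f.
Proof.
intros Hf Hs Hcf Hch (Hn & El & Hor & Hm) [H8 H12] L p p'.
destruct (sqrt_expansion_block f n a Hf Hs Hcf) as (B1 & B2 & Hl & HD & _).
generalize (sqrt_expansion_fundamental f c h n a Hf Hs Hcf Hch).
replace (Nat.even n) with false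
  by (rewrite <- Nat.negb_odd; now apply Nat.odd_spec in Hn as ->).
cbv zeta iota. rewrite El in HD, Hl |- *. rewrite cfmat_palindrome in HD |- *.
apply Forall_palindrome in Hl as [Hl Ham].
(* As [m] is odd, the half block has even length [m - 1]. *)
assert (mdet L = 1) as Hd.
{ unfold L. rewrite mdet_cfmat, length_quotients_upto.
  destruct Hm as [j ->]. replace (2 * j + 1 - 1)%nat with (2 * j)%nat by lia.
  now rewrite Nat.even_mul. }
destruct (cfmat_bounds (quotients_upto a (m - 1))) as (K1 & K2 & K3 & K4 & _ & K6).
{ revert Hl; apply Forall_impl; lia. }
fold L in K1, K2, K3, K4, K6, HD |- *.
destruct (block_eq_palindrome f (a O) (a m) L Hd) as (_ & E2 & E3 & E4).
destruct HD as [_ HD]. rewrite E4, E2 in HD. rewrite E3, E2. intros [-> ->].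
destruct (middle_quotient_two f (a O) (a m) (m11 L) (m12 L) (m21 L) (m22 L))
  as [?|[?|(_ & T & S)]]; trivial; lia.
Qed.

Lemma fundamental_gt1 (D X Y : Z) : 0 < D -> is_fundamental_solution D X Y -> 1 < X.
Proof. intros HD ((H1 & H2 & H3) & _). nia. Qed.

(** For [f = 8] the middle term of the true expansion is [t + 1], while the formula in (ii) gives
    [2 t + 1]; for [f = 12] it is [8 t + 2] against [12 t + 2]. *)
Theorem theorem2 (f c h t : Z) (n : nat) (a : nat -> Z)
    (f_pos : 0 < f)
    (f_nonsquare : ~ exists s : Z, f = s ^ 2)
    (f_cf : sqrt_expansion f n a)
    (ch_fund : is_fundamental_solution f c h)
    (t_ge0 : 0 <= t) :
  (Nat.Even n ->
     is_periodic_cf (sqrt (IZR (f_t f c h t)))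
       ((c - 1) * h * t + a O)
       (quotients_upto a n ++ [2 * (c - 1) * h * t + 2 * a O]))
  /\
  (forall m : nat, odd_case n m a ->
     (* for f = 8 and f = 12 the formula holds only at t = 0 *)
     (t = 0 \/ (f <> 8 /\ f <> 12)) ->
     is_periodic_cf (sqrt (IZR (f_t f c h t)))
       ((c - 1) * h * t + a O)
       (palindrome a m ((c - 1) * h * t + a m)
          ++ [2 * (c - 1) * h * t + 2 * a O]))
  /\
  ((Nat.Even n \/ exists m : nat, odd_case n m a) ->
     is_fundamental_solution (f_t f c h t)
       ((c - 1) * h ^ 4 * t ^ 2 + 2 * (c - 1) * h ^ 2 * t + c)
       (h ^ 3 * t + h)).
Proof.
destruct (sqrt_expansion_block f n a f_pos f_nonsquare f_cf) as (B1 & _ & Hl & HD & _).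
assert (forall P : Z -> Prop, (forall b, 0 < b <= 2 * a O + 1 -> P b) ->
  List.Forall P (quotients_upto a n)) as Hl'.
{ intros P HP. revert Hl. now apply Forall_impl. }
generalize (fundamental_gt1 f c h f_pos ch_fund). intros Hc.
assert (0 < h) as Hh by apply ch_fund.
assert (0 <= (c - 1) * h * t) as Hst by (repeat apply Z.mul_nonneg_nonneg; lia).
assert (t = 0 \/ 0 < (c - 1) * h * t) as Ht.
{ destruct (Z.eq_dec t 0); [now left|right]. repeat apply Z.mul_pos_pos; lia. }
replace (2 * (c - 1) * h * t + 2 * a O) with (2 * ((c - 1) * h * t + a O)) by ring.
assert (Nat.Even n -> block_eq (f_t f c h t) ((c - 1) * h * t + a O) (cfmat (quotients_upto a n)))
  as Heven.
{ intros Hn. generalize (sqrt_expansion_fundamental f c h n a f_pos f_nonsquare f_cf ch_fund).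
  apply Nat.even_spec in Hn as ->. intros [-> ->]. now apply even_shift. }
assert (forall m, odd_case n m a -> List.Forall (fun b => 0 < b <= 2 * a O + 1)
  (palindrome a m (a m))) as Hpal.
{ intros m (_ & <- & _). exact Hl. }
split; [|split].
- intros Hn. apply symmetric_periodic_cf; [lia| |now apply Heven].
  apply Hl'. lia.
- intros m Hm [-> | Hf].
  + rewrite !Z.mul_0_r, !Z.add_0_l. destruct Hm as (_ & <- & _).
    replace (f_t f c h 0) with f by (unfold f_t; ring). apply f_cf.
  + destruct (odd_case_unit f c h n m a f_pos f_nonsquare f_cf ch_fund Hm Hf)
      as (Hd & Ec & Eh & T & S).
    apply symmetric_periodic_cf; [lia| |].
    * apply Hpal, Forall_palindrome in Hm as [H1 H2]. apply Forall_palindrome. split; [|cbv beta in *; lia].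
      revert H1. apply Forall_impl. lia.
    * rewrite cfmat_palindrome, Ec, Eh. now apply odd_shift.
(* At [t = 0] the bound [2 * a 0 + 1] on the terms is too weak for [block_fundamental], but the
   claim is [ch_fund]. A positive shift [s = (c - 1) * h * t] brings all terms below
   [2 * (s + a 0)]. *)
- destruct Ht as [-> | Ht].
  { intros _. replace (f_t f c h 0) with f by (unfold f_t; ring).
    rewrite !Z.mul_0_r, !Z.add_0_l. exact ch_fund. }
  intros [Hn|[m Hm]].
  + generalize (block_fundamental (f_t f c h t) ((c - 1) * h * t + a O) (quotients_upto a n)
      ltac:(lia) (Hl' (fun b => 0 < b < 2 * ((c - 1) * h * t + a O)) ltac:(cbv beta; lia))
      (Heven Hn)).
    generalize (sqrt_expansion_fundamental f c h n a f_pos f_nonsquare f_cf ch_fund).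
    rewrite length_quotients_upto. apply Nat.even_spec in Hn as ->.
    set (M := cfmat _). intros [Ec Eh] K.
    set (p := a O * m11 M + m21 M) in *.
    (* The shifted unit has first entry [p + s q] with [q = m11 M], and
       [s q = 2 p^2 h t q = p h^2 t]. *)
    replace (((c - 1) * h * t + a O) * m11 M + m21 M) with (p * (h ^ 2 * t + 1)) in K
      by (rewrite Ec, Eh; unfold p; ring).
    replace (_ + c) with (2 * (p * (h ^ 2 * t + 1)) ^ 2 + 1) by (rewrite Ec; ring).
    replace (h ^ 3 * t + h) with (2 * (p * (h ^ 2 * t + 1)) * m11 M); [exact K|].
    transitivity ((2 * p * m11 M) * (h ^ 2 * t + 1)); [ring|]. rewrite <- Eh. ring.
  + destruct (Z.eq_dec f 8) as [->|H8].
    { destruct (fundamental_unique 8 c h 3 1 ch_fund (fundamental_4sq 1 ltac:(lia))) as [-> ->].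
      generalize (fundamental_4sq (t + 1) ltac:(lia)). unfold f_t.
      replace (4 * (t + 1) ^ 2 + 4) with ((3 - 1) ^ 2 * 1 ^ 2 * t ^ 2 + 2 * (3 - 1) ^ 2 * t + 8) by ring.
      replace (2 * (t + 1) ^ 2 + 1) with ((3 - 1) * 1 ^ 4 * t ^ 2 + 2 * (3 - 1) * 1 ^ 2 * t + 3) by ring.
      now replace (1 ^ 3 * t + 1) with (t + 1) by ring. }
    destruct (Z.eq_dec f 12) as [->|H12].
    { destruct (fundamental_unique 12 c h 7 2 ch_fund (fundamental_9sq 1 ltac:(lia))) as [-> ->].
      generalize (fundamental_9sq (4 * t + 1) ltac:(lia)). unfold f_t.
      replace (9 * (4 * t + 1) ^ 2 + 3) with ((7 - 1) ^ 2 * 2 ^ 2 * t ^ 2 + 2 * (7 - 1) ^ 2 * t + 12) by ring.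
      replace (6 * (4 * t + 1) ^ 2 + 1) with ((7 - 1) * 2 ^ 4 * t ^ 2 + 2 * (7 - 1) * 2 ^ 2 * t + 7) by ring.
      now replace (2 ^ 3 * t + 2) with (2 * (4 * t + 1)) by ring. }
    destruct (odd_case_unit f c h n m a f_pos f_nonsquare f_cf ch_fund Hm (conj H8 H12))
      as (Hd & Ec & Eh & T & S).
    destruct (odd_shift f (a O) (a m) t _ Hd T S) as (G1 & G2 & G3).
    rewrite <- Ec, <- Eh in G1, G2, G3. rewrite <- cfmat_palindrome in G1, G2, G3.
    rewrite <- G2, <- G3.
    generalize (block_fundamental (f_t f c h t) ((c - 1) * h * t + a O)
      (palindrome a m ((c - 1) * h * t + a m))).
    rewrite even_length_palindrome. intros K; apply K; [lia| |exact G1].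
    (* Keeps the shifted middle term below twice the shifted [a 0]. *)
    assert (a m <= a O) by (destruct Hm as (_ & _ & Hor & _); lia).
    apply Hpal, Forall_palindrome in Hm as [H1 H2]. apply Forall_palindrome. split; [|cbv beta in *; lia].
    revert H1. apply Forall_impl. lia.
Qed.
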